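(* Let $1<p<\infty$, $\alpha<0$, and let $u\in C_c(\mathbb{N}_0)$ be a complex-valued finitely supported sequence with $u(0)=u(1)=0$. Then $$\sum_{n=1}^{\infty}n^{\alpha}|u(n)-u(n-1)|^p\ \ge\ \left(\frac{p-\alpha-1}{p}\right)^p\sum_{n=1}^{\infty}(n+1)^{\alpha-p}|u(n)|^p+\sum_{n=2}^{\infty}n^{\alpha}R_p\bigl(u(n),\hat{\varphi}_{Cop}(n)\bigr),$$ and the constant $\left(\frac{p-\alpha-1}{p}\right)^p$ is optimal (it cannot be replaced by any larger constant so that the inequality still holds for all such $u$).
   Context: $\mathbb{N}_0=\{0,1,2,\dots\}$, and $C_c(\mathbb{N}_0)$ denotes the set of finitely supported sequences on $\mathbb{N}_0$. With $\Gamma$ the Euler Gamma function, set $\varphi_{Cop}(n):=\Gamma\!\left(n+1-\frac{\alpha+1}{p}\right)/\Gamma(n)$ for $n\ge1$, and $\hat{\varphi}_{Cop}(0):=0$, $\hat{\varphi}_{Cop}(n):=\varphi_{Cop}(n+1)$ for $n\ge1$. For $1<p<\infty$ and $\xi,\eta\in\mathbb{C}$, $$C_p(\xi,\eta):=|\xi|^p-|\xi-\eta|^p-p|\xi-\eta|^{p-2}\operatorname{Re}\bigl((\xi-\eta)\overline{\eta}\bigr),$$ where the last term is understood to be $0$ when $\xi=\eta$. For sequences $u$ and $\varphi$ on $\mathbb{N}_0$ with $\varphi>0$ on $\{1,2,\dots\}$ and for $n\ge2$, $$R_p(u(n),\varphi(n)):=C_p\!\left(u(n)-u(n-1),\ \frac{\varphi(n-1)}{\varphi(n)}u(n)-u(n-1)\right)+\varphi(n-1)\bigl(\varphi(n)-\varphi(n-1)\bigr)^{p-1}C_p\!\left(\frac{u(n-1)}{\varphi(n-1)},\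 \frac{u(n-1)}{\varphi(n-1)}-\frac{u(n)}{\varphi(n)}\right).$$ *)

(* Defs.v *)
From mathcomp Require Import all_boot all_order all_algebra.
From mathcomp Require Import all_classical all_reals all_analysis.
From mathcomp.real_closed Require Export complex.

Set Implicit Arguments.
Unset Strict Implicit.
Unset Printing Implicit Defensive.
Import Order.TTheory GRing.Theory Num.Theory.
Import ComplexField.Normc.

Local Open Scope classical_set_scope.
Local Open Scope ring_scope.
Local Open Scope complex_scope.

(* Meaningful for 0 < x, the only range in which it is used. *)
Definition Gamma (R : realType) (x : R) : R :=
  (\int[lebesgue_measure]_(t in `]0%R, +oo[) (t `^ (x - 1) * expR (- t)))%R.

Definition phi_Cop (R : realType) (p alpha : R) (n : nat) : R :=
  Gamma (n%:R + 1 - (alpha + 1) / p) / Gamma n%:R.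

Definition hphi_Cop (R : realType) (p alpha : R) (n : nat) : R :=
  if n == 0%N then 0 else phi_Cop p alpha n.+1.

(* [normc] is the complex modulus with values in [R].  When [xi = eta] the last
   term is 0 for every real [p], because its factor [complex.Re _] vanishes. *)
Definition Cp (R : realType) (p : R) (xi eta : R[i]) : R :=
  normc xi `^ p - normc (xi - eta) `^ p
  - p * normc (xi - eta) `^ (p - 2) * complex.Re ((xi - eta) * eta^*).

(* For [2 <= n] and [phi] positive on the positive integers; it depends on the
   sequences [u] and [phi] through their values at [n.-1] and [n]. *)
Definition Rp (R : realType) (p : R) (u : nat -> R[i]) (phi : nat -> R)
    (n : nat) : R :=
  Cp p (u n - u n.-1) ((phi n.-1 / phi n)%:C * u n - u n.-1)
  + phi n.-1 * (phi n - phi n.-1) `^ (p - 1)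
    * Cp p (u n.-1 / (phi n.-1)%:C)
           (u n.-1 / (phi n.-1)%:C - u n / (phi n)%:C).

Definition finitely_supported (R : realType) (u : nat -> R[i]) : Prop :=
  finite_set [set n | u n != 0].

(* The sums are taken in the extended reals; for a finitely supported [u] only
   finitely many terms are nonzero. *)
Definition Copson_inequality (R : realType) (p alpha c : R) (u : nat -> R[i])
    : Prop :=
  (\sum_(1 <= n <oo) (n%:R `^ alpha * normc (u n - u n.-1) `^ p)%:E
   >= c%:E * \sum_(1 <= n <oo) (n.+1%:R `^ (alpha - p) * normc (u n) `^ p)%:E
      + \sum_(2 <= n <oo)
          (n%:R `^ alpha * Rp p u (hphi_Cop p alpha) n)%:E)%E.

(* Main.v *)
Require Import Defs.
From mathcomp Require Import all_boot all_order all_algebra.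
From mathcomp Require Import all_classical all_reals all_analysis.
From mathcomp Require Import measurable_realfun ring lra.
Import Order.TTheory GRing.Theory Num.Theory.
Import numFieldNormedType.Exports.
Import ComplexField.Normc.

(** Put [s = (p - alpha - 1) / p > 0].  The sequence [hphi_Cop] equals
    [Gamma (n + 1 + s) / Gamma (n + 1)] for [1 <= n], so the functional equation
    of Gamma makes it positive, with [hphi n / hphi (n - 1) = (n + s) / n].

    The remainder [Rp] is built so that the terms of its two [Cp] summands that
    involve a real part cancel.  What is left is an exact Picone-type identity
    ([Cp_picone]): for [0 < B < A],
      [|a - b|^p = Rp + |a|^p ((A - B) / A)^(p-1) - |b|^p ((A - B) / B)^(p-1)].
    With [A = hphi n] and [B = hphi (n - 1)] the two quotients are [s / (n + s)]
    and [s / n].  Multiplying by [n^alpha] and summing by parts, the inequality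
    with a constant [c] becomes the termwise comparison
      [c * sum (n + 1)^(alpha - p) |u n|^p <= sum w n * |u n|^p]
    ([Copson_inequalityE]), where
      [w n = n^alpha (s / (n + s))^(p-1) - (n + 1)^alpha (s / (n + 1))^(p-1)].
    Both claims are therefore statements about the weight [w] alone.

    Factoring out the second term of [w] reduces them to the estimation of
      [r n = (n / (n+1))^alpha * ((n+1) / (n+s))^(p-1)],
    because [w n >= s^p (n + 1)^(alpha - p)] says that [1 + s / (n + 1) <= r n].
    The logarithm of [r n] is bounded on both sides by means of
    [1 - 1/x <= ln x <= x - 1], which can be inserted in each of its two terms
    because [alpha < 0 < p - 1].  The lower bound is exactly [s / (n + 1)], since
    [- alpha + (p - 1) (1 - s) = s], and [expR y >= 1 + y] concludes.  The upper
    bound gives [w n <= s^p (n + 1)^(alpha - p) * q n], where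
    [q n = (n + 1) (n - alpha) / (n^2 + s alpha)] tends to [1].  Testing the
    inequality on the indicator sequence of a single [n] yields
    [c (n + 1)^(alpha - p) <= w n], hence [c <= s^p] in the limit. *)

Local Open Scope classical_set_scope.
Local Open Scope ring_scope.
Local Open Scope complex_scope.

(** * The functional equation of Gamma *)

Section GammaFunction.
Context {R : realType}.
Implicit Types a t x : R.
Notation mu := (@lebesgue_measure R).

Lemma continuous_powR0y a : 0 < a ->
  {within `[0, +oo[, continuous (fun t : R => t `^ a)}.
Proof.
move=> a0; apply/continuous_within_itvcyP; split.
  move=> t t0; apply/differentiable_continuous/derivable1_diffP.
  exact: derivable_powR.
by rewrite powR0 ?gt_eqF//; exact: powR_cvg0.
Qed.

(** This is [y <= expR y] for [y = t / (2 a)], raised to the power [a]. *)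
Lemma powR_le_expR a t : 0 < a -> 0 <= t ->
  t `^ a <= (2 * a) `^ a * expR (t / 2).
Proof.
move=> a0 t0.
have a2 : 0 < 2 * a by rewrite mulr_gt0.
have -> : expR (t / 2) = expR (t / (2 * a)) `^ a.
  by rewrite -expRM; congr expR; field; rewrite gt_eqF.
rewrite -powRM ?expR_ge0 ?(ltW a2)//.
apply: ge0_ler_powR; rewrite ?nnegrE ?mulr_ge0 ?expR_ge0 ?(ltW a0)//.
rewrite [leRHS]mulrC -ler_pdivrMr//.
by apply: le_trans (expR_ge1Dx _); rewrite lerDr.
Qed.

(** An integrable majorant on the half-line.  It serves three times: for the
    integrability of the Gamma integrand, for its decay at infinity, and for the
    correction term in the proof of [GammaD1]. *)
Lemma powR_expRN_le a t : 0 < a -> 0 <= t ->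
  t `^ a * expR (- t) <= (2 * a) `^ a * expR (- t / 2).
Proof.
move=> a0 t0; have -> : - t / 2 = t / 2 + - t by field.
by rewrite expRD mulrA ler_wpM2r ?expR_ge0// powR_le_expR.
Qed.

Lemma continuous_expRN_half : continuous (fun t : R => expR (- t / 2)).
Proof.
move=> t; apply/differentiable_continuous/derivable1_diffP.
exact: ex_derive.
Qed.

Lemma expRN_half_cvg0 : expR (- t / 2) @[t --> +oo] --> (0 : R).
Proof.
rewrite (_ : (fun t => _) = (fun z => expR (- z)) \o (fun z => 2^-1 * z)).
  apply: (@cvg_comp _ _ _ _ _ _ (pinfty_nbhs R)); last exact: cvgr_expR.
  by apply: gt0_cvgMry.
by apply/funext => t /=; congr expR; field.
Qed.

Lemma Gamma_integrand_cvg0 a : 0 < a ->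
  t `^ a * expR (- t) @[t --> +oo] --> (0 : R).
Proof.
move=> a0.
apply: (@squeeze_cvgr _ _ _ _ (fun=> 0)
  (fun t => (2 * a) `^ a * expR (- t / 2))).
- near=> t; rewrite mulr_ge0 ?powR_ge0 ?expR_ge0//=.
  by apply: powR_expRN_le.
- exact: cvg_cst.
- rewrite -[X in _ --> X](mulr0 ((2 * a) `^ a)).
  by apply: cvgMr; exact: expRN_half_cvg0.
Unshelve. all: by end_near. Qed.

Lemma integral_expRN_half :
  (\int[mu]_(t in `[0%R, +oo[) (expR (- t / 2))%:E = 2%:E)%E.
Proof.
rewrite (@ge0_continuous_FTC2y _ _ (fun t => - (2 * expR (- t / 2))) _ 0)//.
- by rewrite oppr0 mul0r expR0 mulr1 EFinN oppeK add0e.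
- exact: (continuous_subspaceT continuous_expRN_half).
- rewrite -oppr0 -(mulr0 2); apply: cvgN; apply: cvgMr; exact: expRN_half_cvg0.
- by apply: cvgN; apply: cvgMr; apply/cvg_at_right_filter/continuous_expRN_half.
- move=> t _; rewrite derive1E derive_val /GRing.scale/=; by field.
Qed.

Lemma integrable_expRN_half :
  mu.-integrable `[0%R, +oo[ (fun t => (expR (- t / 2))%:E).
Proof.
apply/integrableP; split.
  apply/measurable_EFinP/measurable_funTS.
  exact: (continuous_measurable_fun continuous_expRN_half).
under eq_integral do rewrite /= ger0_norm ?expR_ge0//.
by rewrite integral_expRN_half ltry.
Qed.

Lemma measurable_Gamma_integrand a (D : set R) :
  measurable_fun D (fun t : R => t `^ a * expR (- t)).
Proof.
apply: measurable_funTS; apply: measurable_funM.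
  exact: measurable_powR.
by apply: measurableT_comp => //; exact: measurableT_comp.
Qed.

Lemma integrable_Gamma_integrand a : 0 < a ->
  mu.-integrable `[0%R, +oo[ (fun t : R => (t `^ a * expR (- t))%:E).
Proof.
move=> a0; apply: (@le_integrable _ _ _ mu _ _ _
    (fun t => ((2 * a) `^ a)%:E * (expR (- t / 2))%:E)%E) => //.
- apply/measurable_EFinP; exact: measurable_Gamma_integrand.
- move=> t /=; rewrite in_itv/= andbT => t0.
  rewrite !ger0_norm ?mulr_ge0 ?powR_ge0 ?expR_ge0// lee_fin.
  exact: powR_expRN_le.
- by apply: integrableZl => //; exact: integrable_expRN_half.
Qed.

(** For [1 < x] the integrand is continuous up to [0]; closing the interval
    there gives access to the fundamental theorem of calculus on a half-line. *)
Lemma GammaE x : 1 < x ->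
  Gamma x = \int[mu]_(t in `[0, +oo[) (t `^ (x - 1) * expR (- t)).
Proof.
move=> x1; rewrite /Gamma Rintegral_itv_obnd_cbnd//.
apply: integrableS (integrable_Gamma_integrand (x - 1) _) => //.
  by apply: subset_itvr; rewrite bnd_simp.
by rewrite subr_gt0.
Qed.

Lemma continuous_Gamma_integrand a : 0 < a ->
  {within `[0, +oo[, continuous (fun t : R => t `^ a * expR (- t))}.
Proof.
move=> a0.
have cE : {within `[0, +oo[, continuous (fun t : R => expR (- t))}.
  apply: continuous_subspaceT => t.
  by apply: continuous_comp; [exact: continuousN|exact: continuous_expR].
by move=> t; exact: continuousM (continuous_powR0y _ a0 t) (cE t).
Qed.

(** Integration by parts on the half-line.  The derivative of [- t^x exp(-t)]
    changes sign at [t = x], whereas the improper fundamental theorem of calculus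
    is about nonnegative integrands.  Adding [M exp(-t/2)], with [M] so large
    that the sum is nonnegative, repairs this; the added integral is known and
    cancels at the end. *)
Lemma GammaD1 x : 1 < x -> Gamma (x + 1) = x * Gamma x.
Proof.
move=> x1.
have x0 : 0 < x by lra.
have y0 : 0 < x - 1 by lra.
rewrite !GammaE//; last by lra.
rewrite addrK.
pose M := x * (2 * (x - 1)) `^ (x - 1).
have M0 : 0 <= M by rewrite mulr_ge0 ?powR_ge0 ?ltW.
pose F := fun t => - (t `^ x * expR (- t)) - M * (2 * expR (- t / 2)).
pose f := fun t =>
  t `^ x * expR (- t) - x * (t `^ (x - 1) * expR (- t)) + M * expR (- t / 2).
have cE : {within `[0, +oo[, continuous (fun t : R => expR (- t / 2))}.
  by apply: continuous_subspaceT; exact: continuous_expRN_half.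
have cc k : {within `[0%R : R, +oo[, continuous (cst k : R -> R)}.
  by apply: continuous_subspaceT => t; exact: cst_continuous.
have cF : {within `[0, +oo[, continuous F}.
  move=> t; have cg := continuous_Gamma_integrand _ x0 t.
  exact: continuousB (continuousN cg)
    (continuousM (cc M t) (continuousM (cc 2 t) (cE t))).
have dF t : 0 < t -> is_derive t 1 F (f t).
  move=> t0; rewrite /F.
  have d1 := is_derive1_powR x t0.
  apply: is_derive_eq.
  by rewrite /GRing.scale/= /f; field.
have intf : \int[mu]_(t in `[0, +oo[) f t = 0 - F 0.
  apply: Rintegral_ge0_continuous_FTC2y.
  - move=> t t0; rewrite /f -addrA addr_ge0 ?mulr_ge0 ?powR_ge0 ?expR_ge0//.
    rewrite addrC subr_ge0 /M -mulrA ler_wpM2l ?(ltW x0)//.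
    exact: powR_expRN_le.
  - move=> t.
    have cg := continuous_Gamma_integrand _ x0 t.
    have cg' := continuous_Gamma_integrand _ y0 t.
    exact: continuousD (continuousB cg (continuousM (cc x t) cg'))
      (continuousM (cc M t) (cE t)).
  - rewrite -[X in _ --> X](_ : - 0 - M * (2 * 0) = 0); last by ring.
    apply: cvgB; first by apply: cvgN; exact: Gamma_integrand_cvg0.
    by apply: cvgMr; apply: cvgMr; exact: expRN_half_cvg0.
  - by move=> t /dF [].
  - by move/continuous_within_itvcyP : cF => [].
  - by move=> t; rewrite in_itv/= andbT derive1E => /dF [].
have i1 := integrable_Gamma_integrand _ x0.
have i2 := integrable_Gamma_integrand _ y0.
have i3 := integrable_expRN_half.
have i4 : mu.-integrable `[0%R, +oo[
    (EFin \o (fun t => x * (t `^ (x - 1) * expR (- t)))).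
  exact: (integrableZl _ x i2).
have i5 : mu.-integrable `[0%R, +oo[ (EFin \o (fun t => M * expR (- t / 2))).
  exact: (integrableZl _ M i3).
have i6 := integrableB _ i1 i4.
rewrite /f RintegralD ?RintegralB ?RintegralZl// in intf; last exact: i6.
have Ie : \int[mu]_(t in `[0, +oo[) expR (- t / 2) = 2.
  by rewrite /Rintegral integral_expRN_half.
move: intf; rewrite Ie /F powR0 ?gt_eqF// oppr0 !mul0r expR0.
lra.
Qed.

(** Between [1] and [2] the integrand is at least [exp(-2)]. *)
Lemma Gamma_gt0 x : 1 < x -> 0 < Gamma x.
Proof.
move=> x1; rewrite GammaE//.
have y0 : 0 < x - 1 by lra.
have ig := integrable_Gamma_integrand _ y0.
have sub : (`[1, 2]%classic : set R) `<=` `[0, +oo[%classic.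
  by apply: subset_itv; rewrite bnd_simp.
apply: lt_le_trans (expR_gt0 (-2)) _.
have -> : expR (- 2) = \int[mu]_(t in `[1, 2]) expR (- 2) :> R.
  rewrite Rintegral_cst//= lebesgue_measure_itv/= lte_fin ltr1n -EFinB/=.
  lra.
apply: (@le_trans _ _ (\int[mu]_(t in `[1, 2]) (t `^ (x - 1) * expR (- t)))).
  apply: le_Rintegral => //.
  - apply: continuous_compact_integrable; first exact: segment_compact.
    by apply: continuous_subspaceT => t; exact: cst_continuous.
  - by apply: integrableS ig.
  - move=> t /=; rewrite in_itv/= => /andP[t1 t2].
    rewrite -[leLHS]mul1r ler_pM ?ler_expR ?lerN2 ?expR_ge0//.
    by rewrite -[leLHS](powRr0 t); apply: ler_powR => //; exact: ltW.
rewrite /Rintegral fine_le//.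
- by apply: integrable_fin_num => //; apply: integrableS ig.
- by apply: integrable_fin_num.
- apply: ge0_subset_integral => //.
    apply/measurable_EFinP; exact: measurable_Gamma_integrand.
  by move=> t _; rewrite lee_fin mulr_ge0 ?powR_ge0 ?expR_ge0.
Qed.
End GammaFunction.

(** * The Picone-type identity behind the remainder *)

Section Picone.
Context {R : realType}.
Implicit Types (p r x A B k : R) (a b z : R[i]).

Lemma powRV x r : 0 < x -> x^-1 `^ r = (x `^ r)^-1.
Proof.
by move=> x0; rewrite -powRN -powR_inv1 ?(ltW x0)// -powRrM mulN1r.
Qed.

Lemma normc_realM k z : 0 <= k -> normc (k%:C * z) = k * normc z.
Proof.
move=> k0; rewrite normcM; congr (_ * _).
by rewrite /normc /= expr0n /= addr0 sqrtr_sqr ger0_norm.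
Qed.

Lemma normc_ge0 z : 0 <= normc z.
Proof. by case: z => x y; exact: sqrtr_ge0. Qed.

(** The real parts in the two summands are opposite after the scaling by
    [B (A - B)^(p-1)], and the two contributions to [|a|^p] add up through
    [(A - B) / A + B / A = 1]. *)
Lemma Cp_picone p A B a b : 1 < p -> 0 < B -> B < A ->
  Cp p (a - b) ((B / A)%:C * a - b)
  + B * (A - B) `^ (p - 1) * Cp p (b / B%:C) (b / B%:C - a / A%:C) =
  normc (a - b) `^ p - normc a `^ p * ((A - B) / A) `^ (p - 1)
  + normc b `^ p * ((A - B) / B) `^ (p - 1).
Proof.
move=> p1 B0 BA.
have A0 : 0 < A := lt_trans B0 BA.
have An := lt0r_neq0 A0; have Bn := lt0r_neq0 B0.
have D0 : 0 < A - B by rewrite subr_gt0.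
have [k kE] : exists k, k = (A - B) / A by eexists.
have k0 : 0 < k by rewrite kE divr_gt0.
have invC (r : R) z : z / r%:C = r^-1%:C * z.
  by rewrite mulrC; congr (_ * _); rewrite fmorphV.
rewrite /Cp !invC.
have -> : a - b - ((B / A)%:C * a - b) = k%:C * a.
  have -> : k = 1 - B / A by rewrite kE; field.
  rewrite rmorphB rmorph1; ring.
have -> : B^-1%:C * b - (B^-1%:C * b - A^-1%:C * a) = A^-1%:C * a by ring.
have N0 := normc_ge0.
have Ai0 : 0 < A^-1 by rewrite invr_gt0.
have Bi0 : 0 < B^-1 by rewrite invr_gt0.
have Ai0' := ltW Ai0; have Bi0' := ltW Bi0; have k0' := ltW k0.
rewrite !normc_realM//.
rewrite -kE !(powRM _ _ (N0 _)) ?(powRM _ k0') ?(powRM _ Ai0') ?(powRM _ Bi0')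
  ?(powRM _ (ltW D0))//.
set M := normc a `^ (p - 2).
have p0 : 0 < p by lra.
have powS (x : R) : 0 < x -> x `^ p = x * x `^ (p - 1).
  by move=> x0; rewrite mulr_powRB1// ltW.
have powS2 (x : R) : 0 < x -> x `^ (p - 2) = x^-1 * x `^ (p - 1).
  move=> x0; rewrite (_ : p - 2 = p - 1 - 1); last by ring.
  rewrite [LHS]powRB; last by rewrite (gt_eqF x0) implybT.
  by rewrite powRr1 ?(ltW x0)// mulrC.
rewrite (powS k k0) (powS _ Ai0) (powS _ Bi0) (powS2 k k0) (powS2 _ Ai0) invrK.
have DE : A - B = k * A by rewrite kE; field.
rewrite DE.
rewrite !(powRM _ (ltW k0) (ltW A0)) !powRV//.
have : A `^ (p - 1) != 0 by rewrite gt_eqF ?powR_gt0.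
have : B `^ (p - 1) != 0 by rewrite gt_eqF ?powR_gt0.
move: (A `^ (p - 1)) (B `^ (p - 1)) (k `^ (p - 1)) => A' B' k' B'0 A'0.
have kn : k != 0 by rewrite gt_eqF.
(* Both real parts are combinations of [|a|^2] and of the real part of [a] times
   the conjugate of [b]; once this is visible, they cancel. *)
have -> : complex.Re (k%:C * a * ((B / A)%:C * a - b)^*) =
    k * (B / A * complex.Re (a * a^*) - complex.Re (a * b^*)).
  by case: (a) (b) => [a1 a2] [b1 b2] /=; ring.
have -> : complex.Re ((A^-1)%:C * a * ((B^-1)%:C * b - (A^-1)%:C * a)^*) =
    A^-1 * (B^-1 * complex.Re (a * b^*) - A^-1 * complex.Re (a * a^*)).
  by case: (a) (b) => [a1 a2] [b1 b2] /=; ring.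
move: (complex.Re _) (complex.Re _) (normc (a - b) `^ p) (normc b `^ p)
  => N X ab bp.
by rewrite kE; field; rewrite ?An ?Bn ?A'0 ?B'0 (gt_eqF D0).
Qed.

End Picone.

(** * Finite sums *)

Section Sums.
Context {R : realType}.

Lemma eseries_finite (m N : nat) (f : nat -> \bar R) :
  (forall n, (N <= n)%N -> f n = 0%E) ->
  (\sum_(m <= n <oo) f n = \sum_(m <= n < N) f n)%E.
Proof.
move=> f0; apply/cvg_lim => //; apply: cvg_near_cst; near=> n.
have Nn : (N <= n)%N by near: n; exact: nbhs_infty_ge.
have Z (i j : nat) : (N <= i)%N -> (\sum_(i <= k < j) f k = 0)%E.
  by move=> Ni; rewrite big_nat big1// => k /andP[/(leq_trans Ni)/f0].
have [Nm|mN] := leqP N m; first by rewrite [RHS]big_geq// Z.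
by rewrite (@big_cat_nat _ _ _ N)//= ?(ltnW mN)// (Z N n)// adde0.
Unshelve. all: by end_near. Qed.

Lemma finitely_supported_eventually0 (u : nat -> R[i]) :
  finitely_supported u -> exists N, forall n, (N <= n)%N -> u n = 0.
Proof.
move=> /finite_seqP[s us]; exists (\max_(i <- s) i).+1 => n sn.
apply/eqP/negPn/negP => un.
have : [set` s] n by rewrite -us.
move=> /= ns; move: sn; rewrite ltnNge; apply/negP/negPn.
exact: leq_bigmax_seq.
Qed.

(** Summation by parts with vanishing boundary terms. *)
Lemma sumr_shift_pred (g h : nat -> R) N : h 1%N = 0 -> h N.+1 = 0 ->
  \sum_(2 <= n < N.+2) (g n - h n.-1) = \sum_(2 <= n < N.+2) (g n - h n).
Proof.
move=> h1 hN; rewrite !sumrB; congr (_ - _); case: N hN => [|N] hN.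
  by rewrite !big_geq.
by rewrite big_add1/= big_ltn// h1 add0r [RHS]big_nat_recr//= hN addr0.
Qed.
End Sums.

(** * The weight and its estimates *)

(** The parameter [s] is characterized by [p * s = p - alpha - 1] to keep
    quotients by [p] out of the computations. *)
Section Weights.
Context {R : realType}.
Variables (p alpha s : R).
Hypotheses (p1 : 1 < p) (alpha0 : alpha < 0) (s0 : 0 < s).
Hypothesis ps : p * s = p - alpha - 1.

Lemma p_gt0 : 0 < p.
Proof. exact: lt_trans ltr01 p1. Qed.

Lemma s_fixed : - alpha + (p - 1) * (1 - s) = s.
Proof. by rewrite mulrBr mulr1 mulrBl ps mul1r; ring. Qed.

Lemma Cop_shiftE (x : R) : x + 1 - (alpha + 1) / p = x + s.
Proof.
have -> : s = (p - alpha - 1) / p.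
  by rewrite -ps mulrAC divff ?mul1r// gt_eqF ?p_gt0.
by field; rewrite gt_eqF ?p_gt0.
Qed.

Lemma hphi_Cop_gt0 n : (0 < n)%N -> 0 < hphi_Cop p alpha n.
Proof.
case: n => // n _; rewrite /hphi_Cop /= /phi_Cop.
have n0 : 0 <= n%:R :> R by [].
rewrite Cop_shiftE.
have s0' := s0.
have n2 : n.+2%:R = n%:R + 2 :> R by rewrite -addn2 natrD.
by rewrite divr_gt0// Gamma_gt0// n2; lra.
Qed.

Lemma hphi_CopS n : (0 < n)%N ->
  hphi_Cop p alpha n.+1 = hphi_Cop p alpha n * ((n.+1%:R + s) / n.+1%:R).
Proof.
case: n => // n _; rewrite /hphi_Cop /= /phi_Cop.
have n0 : 0 <= n%:R :> R by [].
rewrite !Cop_shiftE.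
have s0' := s0.
have n2 : n.+2%:R = n%:R + 2 :> R by rewrite -addn2 natrD.
by rewrite -[n.+3%:R]natr1 addrAC !GammaD1 ?n2; lra.
Qed.

(** The coefficient that [|u n|^p] receives after summation by parts. *)
Definition Hardy_weight (n : nat) : R :=
  n%:R `^ alpha * (s / (n%:R + s)) `^ (p - 1)
  - n.+1%:R `^ alpha * (s / n.+1%:R) `^ (p - 1).

(** The quotient of the two terms of [Hardy_weight]. *)
Definition weight_ratio (n : nat) : R :=
  (n%:R / n.+1%:R) `^ alpha * (n.+1%:R / (n%:R + s)) `^ (p - 1).

Lemma Hardy_weightE n : (0 < n)%N ->
  Hardy_weight n =
  s `^ (p - 1) * n.+1%:R `^ (alpha - p + 1) * (weight_ratio n - 1).
Proof.
move=> n0.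
have N0 : 0 < n%:R :> R by rewrite ltr0n.
rewrite /Hardy_weight /weight_ratio.
rewrite (_ : alpha - p + 1 = alpha - (p - 1)); last by ring.
rewrite powRB; last by rewrite pnatr_eq0 implybT.
have N1 : 0 < n.+1%:R :> R by rewrite ltr0n.
have ns0 : 0 < n%:R + s by rewrite addr_gt0.
have [N0' N1' ns0' s0'] : [/\ 0 <= n%:R^-1 :> R, 0 <= n.+1%:R^-1 :> R,
    0 <= (n%:R + s)^-1 & 0 <= s].
  by rewrite !invr_ge0 !ltW.
rewrite !(powRM _ s0') // !(powRM _ (ler0n _ _))// !powRV//.
have := powR_gt0 alpha N1; have := powR_gt0 (p - 1) N1.
have := powR_gt0 (p - 1) ns0.
move: (n.+1%:R `^ alpha) (n.+1%:R `^ (p - 1)) ((n%:R + s) `^ (p - 1))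
  => x y z z0 y0 x0.
by field; rewrite !gt_eqF.
Qed.

Lemma ln_div_le (x y : R) : 0 < x -> 0 < y -> ln (x / y) <= (x - y) / y.
Proof.
move=> x0 y0; rewrite mulrBl divff ?gt_eqF//.
have := @le_ln1Dx _ (x / y - 1); rewrite addrCA subrr addr0; apply.
by rewrite ltrDr divr_gt0.
Qed.

Lemma ln_div_ge (x y : R) : 0 < x -> 0 < y -> (x - y) / x <= ln (x / y).
Proof.
move=> x0 y0; rewrite -[x / y]invf_div lnV ?posrE ?divr_gt0// lerNr.
by rewrite -mulNr opprB ln_div_le.
Qed.

Lemma weight_ratio_expR n : (0 < n)%N ->
  weight_ratio n =
  expR (alpha * ln (n%:R / n.+1%:R) + (p - 1) * ln (n.+1%:R / (n%:R + s))).
Proof.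
move=> n0.
have N0 : 0 < n%:R :> R by rewrite ltr0n.
have N1 : 0 < n.+1%:R :> R by rewrite ltr0n.
by rewrite /weight_ratio /powR !gt_eqF ?divr_gt0 ?addr_gt0// expRD.
Qed.

Lemma weight_ratio_ge n : (0 < n)%N -> 1 + s / n.+1%:R <= weight_ratio n.
Proof.
move=> n0; rewrite weight_ratio_expR// -natr1.
have : 0 < n%:R :> R by rewrite ltr0n.
move: (n%:R : R) => x x0; have s0' := s0.
have x1 : 0 < x + 1 by lra.
have xs : 0 < x + s by lra.
apply: le_trans (expR_ge1Dx _) _; rewrite ler_expR.
have -> : s / (x + 1) =
    alpha * ((x - (x + 1)) / (x + 1)) + (p - 1) * ((x + 1 - (x + s)) / (x + 1)).
  by rewrite -{1}s_fixed; field; rewrite gt_eqF.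
apply: lerD; first by rewrite ler_nM2l// ln_div_le.
by rewrite ler_pM2l ?subr_gt0// ln_div_ge.
Qed.

(** The exponent is at most [y = s (n - alpha) / (n (n + s))], and
    [expR y <= 1 / (1 - y)]. *)
Lemma weight_ratio_le n : (0 < n)%N -> 0 < n%:R ^+ 2 + s * alpha ->
  weight_ratio n - 1 <= s * (n%:R - alpha) / (n%:R ^+ 2 + s * alpha).
Proof.
move=> n0; rewrite weight_ratio_expR// -natr1.
have : 0 < n%:R :> R by rewrite ltr0n.
move: (n%:R : R) => x x0 D0; have s0' := s0.
have x1 : 0 < x + 1 by lra.
have xs : 0 < x + s by lra.
pose y := s * (x - alpha) / (x * (x + s)).
have yE : y =
    alpha * ((x - (x + 1)) / x) + (p - 1) * ((x + 1 - (x + s)) / (x + s)).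
  have -> : (p - 1) * ((x + 1 - (x + s)) / (x + s)) = (s + alpha) / (x + s).
    by rewrite mulrA; congr (_ / _); have := s_fixed; lra.
  by rewrite /y; field; rewrite !gt_eqF.
have y'E : 1 - y = (x ^+ 2 + s * alpha) / (x * (x + s)).
  by rewrite /y; field; rewrite !gt_eqF.
have y'0 : 0 < 1 - y by rewrite y'E divr_gt0// mulr_gt0.
have -> : s * (x - alpha) / (x ^+ 2 + s * alpha) = (1 - y)^-1 - 1.
  by rewrite y'E; field; rewrite !gt_eqF.
rewrite lerD2r; apply: (@le_trans _ _ (expR y)).
  rewrite ler_expR yE; apply: lerD; first by rewrite ler_nM2l// ln_div_ge.
  by rewrite ler_pM2l ?subr_gt0// ln_div_le.
rewrite -[y in expR y]opprK expRN lef_pV2 ?posrE ?expR_gt0//.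
exact: expR_ge1Dx.
Qed.

Lemma Hardy_weight_ge n : (0 < n)%N ->
  s `^ p * n.+1%:R `^ (alpha - p) <= Hardy_weight n.
Proof.
move=> n0.
have N1 : 0 < n.+1%:R :> R by rewrite ltr0n.
rewrite Hardy_weightE// -(mulr_powRB1 (ltW s0) p_gt0).
have -> : s * s `^ (p - 1) * n.+1%:R `^ (alpha - p) =
    s `^ (p - 1) * n.+1%:R `^ (alpha - p + 1) * (s / n.+1%:R).
  rewrite [X in _ = _ * X * _]powRD; last by rewrite (gt_eqF N1) implybT.
  by rewrite powRr1 ?ler0n//; field; rewrite gt_eqF.
rewrite ler_pM2l ?mulr_gt0 ?powR_gt0// lerBrDl.
exact: weight_ratio_ge.
Qed.

(** If [K = s^p < c], then [c (n^2 + s alpha) <= K (n + 1) (n - alpha)] fails as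
    soon as [n (c - K)] exceeds [b], which bounds the terms of lower order
    divided by [n]. *)
Lemma le_of_le_Hardy_weight (c : R) :
  (forall n, (1 < n)%N -> c * n.+1%:R `^ (alpha - p) <= Hardy_weight n) ->
  c <= s `^ p.
Proof.
move=> H; rewrite leNgt; apply/negP => Kc.
set K := s `^ p in Kc.
have K0 : 0 < K by rewrite powR_gt0.
pose b := K * (1 - 2 * alpha) - c * s * alpha.
have c0 : 0 < c by lra.
have csa : 0 < c * s * - alpha by rewrite !mulr_gt0// oppr_gt0.
have sa : 0 < s * - alpha by rewrite !mulr_gt0// oppr_gt0.
have Ka : 0 < K * - alpha by rewrite !mulr_gt0// oppr_gt0.
pose n := (Num.truncn (b / (c - K)) + Num.truncn (s * - alpha) + 2)%N.
have n1 : (1 < n)%N by rewrite /n addn2.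
have N1 : 1 <= n%:R :> R by rewrite ler1n ltnW.
have nb : b < n%:R * (c - K).
  rewrite -ltr_pdivrMr ?subr_gt0//.
  apply: lt_le_trans (truncnS_gt _) _.
  by rewrite ler_nat /n addn2 ltnS -addnS leq_addr.
have nsa : s * - alpha < n%:R.
  apply: lt_le_trans (truncnS_gt _) _.
  by rewrite ler_nat /n addn2 ltnS -addSn leq_addl.
have D0 : 0 < n%:R ^+ 2 + s * alpha.
  have : n%:R <= n%:R ^+ 2 :> R by rewrite expr2 ler_peMl ?ler0n.
  lra.
have := H n n1; rewrite Hardy_weightE; last exact: ltnW.
have n2 : (n.+1%:R : R) = n%:R + 1 by rewrite natr1.
have N2 : 0 < n.+1%:R :> R by rewrite ltr0n.
have Hr := weight_ratio_le n (ltnW n1) D0.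
have Q0 : 0 < n.+1%:R `^ (alpha - p) :> R by rewrite powR_gt0.
rewrite [n.+1%:R `^ (alpha - p + 1)]powRD; last first.
  by rewrite (gt_eqF N2) implybT.
rewrite powRr1 ?ler0n// => h.
have {h} : c <= s `^ (p - 1) * n.+1%:R *
    (s * (n%:R - alpha) / (n%:R ^+ 2 + s * alpha)).
  rewrite -(ler_pM2r Q0); apply: le_trans h _.
  rewrite [leLHS](_ : _ =
    s `^ (p - 1) * n.+1%:R * (weight_ratio n - 1) * n.+1%:R `^ (alpha - p));
    last by ring.
  by rewrite ler_pM2r// ler_pM2l// mulr_gt0// powR_gt0.
have -> : s `^ (p - 1) * n.+1%:R *
      (s * (n%:R - alpha) / (n%:R ^+ 2 + s * alpha)) =
    K * (n%:R + 1) * (n%:R - alpha) / (n%:R ^+ 2 + s * alpha).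
  by rewrite /K -(mulr_powRB1 (ltW s0) p_gt0) n2; field; rewrite gt_eqF.
rewrite ler_pdivlMr//.
apply/negP; rewrite -ltNge.
have : n%:R * b < n%:R * (n%:R * (c - K)) by rewrite ltr_pM2l// ltr0n ltnW.
rewrite /b; move: (n%:R : R) N1 => x x1.
have Y0 : 0 <= x - 1 by lra.
have := mulr_ge0 Y0 (ltW Ka).
have := mulr_ge0 Y0 (ltW csa).
nra.
Qed.

(** * Reduction of the inequality to the weight *)

Lemma Rp_hphi_Cop (u : nat -> R[i]) n : (1 < n)%N ->
  Rp p u (hphi_Cop p alpha) n =
  normc (u n - u n.-1) `^ p - normc (u n) `^ p * (s / (n%:R + s)) `^ (p - 1)
  + normc (u n.-1) `^ p * (s / n%:R) `^ (p - 1).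
Proof.
case: n => [|n]// n0.
have h0 := hphi_Cop_gt0 n n0.
have N1 : 0 < n.+1%:R :> R by rewrite ltr0n.
have ns0 : 0 < n.+1%:R + s by rewrite addr_gt0.
have hS := hphi_CopS n n0.
rewrite /Rp /= Cp_picone//.
  congr (_ - _ * _ `^ _ + _ * _ `^ _); rewrite hS;
    move: (n.+1%:R : R) N1 ns0 {hS} => x x0 xs0; field;
    by rewrite !gt_eqF.
by rewrite hS ltr_pMr// ltr_pdivlMr// mul1r ltrDl.
Qed.

(** The remainder cancels against the left-hand side up to a telescoping sum,
    whose boundary terms vanish because [u 1 = 0] and [u] has finite support. *)
Lemma Copson_inequalityE c (u : nat -> R[i]) N :
  u 0%N = 0 -> u 1%N = 0 -> (forall n, (N < n)%N -> u n = 0) ->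
  Copson_inequality p alpha c u <->
  c * (\sum_(2 <= n < N.+2) n.+1%:R `^ (alpha - p) * normc (u n) `^ p)
  <= \sum_(2 <= n < N.+2) Hardy_weight n * normc (u n) `^ p.
Proof.
move=> u0 u1 uN; rewrite /Copson_inequality.
have norm0 : normc (0 : R[i]) `^ p = 0 by rewrite normc0 powR0// gt_eqF ?p_gt0.
have uN' n : (N.+1 < n)%N -> u n = 0 /\ u n.-1 = 0.
  case: n => // n nN; split; apply: uN => //.
  exact: ltnW.
rewrite !(@eseries_finite _ _ N.+2).
- rewrite !(@big_ltn _ _ _ 1)//.
  rewrite /= u1 u0 subrr norm0 !mulr0 !add0e.
  rewrite !sumEFin -EFinM -EFinD lee_fin -lerBrDr -sumrB.
  rewrite [X in _ <= X](_ : _ =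
    \sum_(2 <= n < N.+2) Hardy_weight n * normc (u n) `^ p)//.
  pose g n := n%:R `^ alpha * (s / (n%:R + s)) `^ (p - 1) * normc (u n) `^ p.
  pose h n := n.+1%:R `^ alpha * (s / n.+1%:R) `^ (p - 1) * normc (u n) `^ p.
  transitivity (\sum_(2 <= n < N.+2) (g n - h n.-1)).
    apply: eq_big_nat => n /andP[n2 _]; rewrite Rp_hphi_Cop// /g /h.
    by rewrite prednK ?(ltnW n2)//; ring.
  rewrite sumr_shift_pred.
  + by apply: eq_bigr => n _; rewrite /g /h /Hardy_weight; ring.
  + by rewrite /h u1 norm0 mulr0.
  + by rewrite /h uN// norm0 mulr0.
- by move=> n nN; have [un un'] := uN' n nN; rewrite un un' subrr norm0 mulr0.
- move=> n nN; have [un un'] := uN' n nN.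
  rewrite Rp_hphi_Cop ?(leq_trans _ nN)// un un' subrr norm0.
  by rewrite !mul0r addr0 subr0 mulr0.
- by move=> n nN; have [un un'] := uN' n nN; rewrite un norm0 mulr0.
Qed.

End Weights.

Theorem corollary3p4 (R : realType) (p alpha : R)
    (hp : 1 < p) (halpha : alpha < 0) :
  (forall u : nat -> R[i],
     finitely_supported u -> u 0%N = 0 -> u 1%N = 0 ->
     Copson_inequality p alpha (((p - alpha - 1) / p) `^ p) u) /\
  (forall c : R,
     (forall u : nat -> R[i],
        finitely_supported u -> u 0%N = 0 -> u 1%N = 0 ->
        Copson_inequality p alpha c u) ->
     c <= ((p - alpha - 1) / p) `^ p).
Proof.
have p0 : 0 < p := lt_trans ltr01 hp.
have s0 : 0 < (p - alpha - 1) / p by rewrite divr_gt0//; lra.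
have ps : p * ((p - alpha - 1) / p) = p - alpha - 1.
  by rewrite mulrCA divff ?mulr1// gt_eqF.
split=> [u /finitely_supported_eventually0[N uN] u0 u1|c H].
  apply/(Copson_inequalityE _ _ _ hp s0 ps _ _ N) => //.
    by move=> n /ltnW; exact: uN.
  rewrite mulr_sumr; apply: ler_sum_nat => n /andP[n2 _].
  rewrite mulrA ler_wpM2r ?powR_ge0//.
  by apply: Hardy_weight_ge => //; exact: ltnW.
apply: (le_of_le_Hardy_weight _ _ _ hp halpha s0 ps) => n n1.
(* A test sequence with a single nonzero entry reduces both sums to one term. *)
pose u m : R[i] := if m == n then 1 else 0.
have un m : m != n -> u m = 0 by rewrite /u => /negPf ->.
have u0 : u 0%N = 0 by rewrite un// ltn_eqF// ltnW.
have u1 : u 1%N = 0 by rewrite un// ltn_eqF.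
have : Copson_inequality p alpha c u.
  apply: H => //.
  apply: (@sub_finite_set _ _ [set n]) => // m /= um.
  by apply/eqP/negPn/negP => /un; move/eqP; apply/negP.
have uN m : (n < m)%N -> u m = 0 by move=> nm; rewrite un// gtn_eqF.
rewrite (Copson_inequalityE _ _ _ hp s0 ps _ _ n)//.
have sumE (w : nat -> R) : \sum_(2 <= m < n.+2) w m * normc (u m) `^ p = w n.
  rewrite (bigD1_seq n) ?iota_uniq ?mem_index_iota ?n1 ?leqnSn//=.
  rewrite big1 => [|m mn]; last by rewrite un// normc0 powR0 ?gt_eqF// mulr0.
  by rewrite /u eqxx normc1 powR1 mulr1 addr0.
by rewrite !sumE.
Qed.
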